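(* Let $G=(V,E)$ be a connected graph on $n$ vertices with maximum degree at most $d$ in a minor-closed family excluding some fixed graph $H$ as a minor, and let $\varepsilon>0$ be sufficiently small. Let $F\subseteq V$ be an arbitrary set with $|F|\ge\beta n$. Then there are at least $\beta^2n/8$ vertices $s\in F$ such that for at least $\beta\ell/8$ timesteps $t\in\{1,\dots,\ell\}$, $\sum_{u\in F}(\widehat{M}^t\vec s)(u)\ge \beta/16$.
   Context: Parameters: $\beta=\varepsilon/10$, $\ell=d^6\varepsilon^{-30}$, $\rho=d^{-60}\varepsilon^{3000}$. Let $M$ be the $n\times n$ matrix with $M_{u,v}=M_{v,u}=1/(2d)$ for every edge $\{u,v\}$, $M_{v,v}=1-\deg(v)/(2d)$, and all other entries $0$. For a vertex $v$, $\vec v$ is its standard basis vector. For nonnegative $\vec x$, $\widehat{M}\vec x$ is obtained from $M\vec x$ by zeroing every coordinate with value at most $\rho$, and $\widehat{M}^t\vec x=\widehat{M}(\widehat{M}^{t-1}\vec x)$. *)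

(* Defs.v *)
From mathcomp Require Export all_boot all_order all_algebra.
From mathcomp Require Export reals.

Set Implicit Arguments.
Unset Strict Implicit.
Unset Printing Implicit Defensive.

Import Order.TTheory GRing.Theory Num.Theory.
Local Open Scope ring_scope.

(* Finite simple graphs on the vertex set {0, ..., n-1}. *)
Record sgraph (n : nat) := SGraph {
  adj :> rel 'I_n;
  adj_sym : symmetric adj;
  adj_irr : irreflexive adj }.

Definition deg n (G : sgraph n) (v : 'I_n) : nat := #|[set u | G v u]|.

Definition connected n (G : sgraph n) : Prop := forall u v, connect G u v.

Definition induces_connected n (G : sgraph n) (S : {set 'I_n}) : Prop :=
  {in S &, forall u v, connect [rel x y | [&& x \in S, y \in S & G x y]] u v}.

(* K is a minor of G, given by a model: the branch set B x is the set of
   vertices of G contracted to the vertex x of K. *)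
Definition minor k (K : sgraph k) n (G : sgraph n) : Prop :=
  exists B : 'I_k -> {set 'I_n},
    [/\ forall x, B x != set0,
        forall x, induces_connected G (B x),
        forall x y, x != y -> [disjoint B x & B y]
      & forall x y, K x y -> exists u v, [/\ u \in B x, v \in B y & G u v]].

Definition graph_family := forall n, sgraph n -> Prop.

Definition minor_closed (P : graph_family) : Prop :=
  forall n (G : sgraph n) k (K : sgraph k), P n G -> minor K G -> P k K.

Definition excludes_minor (P : graph_family) h (H : sgraph h) : Prop :=
  forall n (G : sgraph n), P n G -> ~ minor H G.

Section Walks.
Variable R : realType.

Definition beta (eps : R) : R := eps / 10.
Definition ell (d : nat) (eps : R) : R := d%:R ^+ 6 * eps ^- 30.
Definition rho (d : nat) (eps : R) : R := d%:R ^- 60 * eps ^+ 3000.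

Definition walk_mx (d n : nat) (G : sgraph n) : 'M[R]_n :=
  \matrix_(u, v)
    if u == v then 1 - (deg G v)%:R / (2 * d%:R)
    else if G u v then 1 / (2 * d%:R) else 0.

Definition trunc_walk (d : nat) (eps : R) n (G : sgraph n) (x : 'cV[R]_n) :
    'cV[R]_n :=
  map_mx (fun a => if a <= rho d eps then 0 else a) (walk_mx d G *m x).

Definition trunc_walk_from (d : nat) (eps : R) n (G : sgraph n) (s : 'I_n)
    (t : nat) : 'cV[R]_n :=
  iter t (trunc_walk d eps G) (delta_mx s 0).

(* ell need not be an integer; the timesteps are the integers 1 <= t <= ell. *)
Definition timesteps (d : nat) (eps : R) : seq nat :=
  iota 1 (Num.truncn (ell d eps)).

Definition num_good_timesteps (d : nat) (eps : R) n (G : sgraph n)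
    (F : {set 'I_n}) (s : 'I_n) : nat :=
  count (fun t => beta eps / 16 <= \sum_(u in F) trunc_walk_from d eps G s t u 0)
        (timesteps d eps).

End Walks.

(* Main.v *)
Require Import Defs.
From mathcomp Require Import zify ring lra.

Set Implicit Arguments.
Unset Strict Implicit.
Unset Printing Implicit Defensive.

Import Order.TTheory GRing.Theory Num.Theory.

(** An H-minor-free graph has no K_h model, so the Plotkin-Rao-Smith argument
    gives a balanced separator of size about m / l + h^2 l log m in every set of
    m vertices.  Splitting recursively, with l = l0 (j+1)(j+2) for pieces of size
    about 2^q (3/2)^j, the costs telescope: removing a set S of at most 2n / l0
    vertices leaves blocks of size at most 2^q, a polynomial in l0.

    Let N be the walk matrix restricted to the blocks, f the indicator of F and
    x = N^(t/2) f.  As N is symmetric with diagonal at least 1/2, f^T N^t f is at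
    least |x|^2 / 2 >= (sum x)^2 / 2n, and sum x >= |F| - t |S|; hence a walk
    started at a uniform vertex of F is in F at time t with probability about
    beta / 2.  Truncation costs at most rho per step and coordinate, and a walk
    of N only visits the at most 2^q coordinates of one block, so the truncated
    walk loses at most 2^q l rho, which is negligible.  Two averaging steps turn
    this into many starting points with many good times. *)

(** * Separators in graphs without a clique minor *)

Section Separator.
Variables (T : finType) (e : rel T).
Hypothesis e_sym : symmetric e.

Definition rel_in (X : {set T}) : rel T := [rel x y | [&& x \in X, y \in X & e x y]].
Definition conn (X : {set T}) : Prop := {in X &, forall u v, connect (rel_in X) u v}.
Definition touch (X Y : {set T}) : bool := [exists x in X, exists y in Y, e x y].

Lemma touchP (X Y : {set T}) : reflect (exists x y, [/\ x \in X, y \in Y & e x y]) (touch X Y).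
Proof.
apply: (iffP exists_inP) => [[x xX /exists_inP[y yY exy]]|[x [y [xX yY exy]]]].
  by exists x, y.
by exists x => //; apply/exists_inP; exists y.
Qed.

Lemma connect_rel_inS (X Y : {set T}) u v :
  X \subset Y -> connect (rel_in X) u v -> connect (rel_in Y) u v.
Proof.
move=> /subsetP sXY; apply: connect_sub => x y /= /and3P[xX yX exy].
by apply: connect1; apply/and3P; split; rewrite ?sXY.
Qed.

Lemma conn1 x : conn [set x].
Proof. by move=> u v /set1P-> /set1P->; apply: connect0. Qed.

Lemma conn_edge x y : e x y -> conn [set x; y].
Proof.
move=> exy u v /set2P[]-> /set2P[]->; rewrite ?connect0 //; apply: connect1;
  by apply/and3P; rewrite !inE !eqxx ?orbT // e_sym.
Qed.

Lemma connU (X Y : {set T}) x :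
  conn X -> conn Y -> x \in X -> x \in Y -> conn (X :|: Y).
Proof.
move=> cX cY xX xY.
have to_x u : u \in X :|: Y -> connect (rel_in (X :|: Y)) u x
    /\ connect (rel_in (X :|: Y)) x u.
  case/setUP => [uX|uY]; split.
  - exact: connect_rel_inS (subsetUl _ _) (cX _ _ uX xX).
  - exact: connect_rel_inS (subsetUl _ _) (cX _ _ xX uX).
  - exact: connect_rel_inS (subsetUr _ _) (cY _ _ uY xY).
  - exact: connect_rel_inS (subsetUr _ _) (cY _ _ xY uY).
move=> u v uXY vXY; exact: connect_trans (to_x u uXY).1 (to_x v vXY).2.
Qed.

(** * Balls inside a set, and cuts along sparse layers *)

Definition ball_step (R X : {set T}) : {set T} :=
  X :|: [set y in R | [exists x in X, e x y]].
Definition ball (R : {set T}) v j : {set T} := iter j (ball_step R) [set v].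

Lemma ballS (R : {set T}) v j : ball R v j \subset ball R v j.+1.
Proof. exact: subsetUl. Qed.

Lemma ball_mono (R : {set T}) v i j : i <= j -> ball R v i \subset ball R v j.
Proof.
move=> /subnK <-; elim: (j - i) => [|k IH]; first by rewrite add0n.
by rewrite addSn; apply: subset_trans IH (ballS _ _ _).
Qed.

Lemma ball_center (R : {set T}) v j : v \in ball R v j.
Proof. by apply: (subsetP (ball_mono R v (leq0n j))); rewrite /= set11. Qed.

Lemma ball_sub (R : {set T}) v j : v \in R -> ball R v j \subset R.
Proof.
move=> vR; elim: j => [|j IH] /=; first by rewrite sub1set.
by rewrite subUset IH /=; apply/subsetP => y; rewrite inE => /andP[].
Qed.

Lemma ball_nbr (R : {set T}) v j x y :
  x \in ball R v j -> y \in R -> e x y -> y \in ball R v j.+1.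
Proof.
move=> xb yR exy; rewrite /= !inE yR /=; apply/orP; right.
by apply/exists_inP; exists x.
Qed.

Lemma ball_path (R : {set T}) v j y : v \in R -> y \in ball R v j ->
  exists X : {set T}, [/\ v \in X, y \in X, X \subset R, conn X & #|X| <= j.+1].
Proof.
move=> vR; elim: j y => [|j IH] y /=.
  by move/set1P->; exists [set v]; rewrite set11 sub1set cards1; split => //; apply: conn1.
case/setUP => [/IH[X [vX yX sX cX le]]|].
  by exists X; split => //; apply: leqW.
rewrite inE => /andP[yR /exists_inP[x /IH[X [vX xX sX cX le]] exy]].
exists (X :|: [set x; y]); split.
- by rewrite inE vX.
- by rewrite !inE eqxx !orbT.
- by rewrite !subUset sX !sub1set yR (subsetP sX).
- by apply: (connU cX (conn_edge exy) xX); rewrite !inE eqxx.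
rewrite setUA; apply: leq_trans (_ : #|y |: X| <= _).
  apply/subset_leq_card/subsetP => z; rewrite !inE.
  by move=> /orP[/orP[->|/eqP->]|->]; rewrite ?xX ?orbT.
by rewrite cardsU1; case: (_ \notin _) => //=; lia.
Qed.

(** The first two binomial terms of [(l + 1) ^ l] both equal [l ^ l]. Hence [l] successive growths
    by a factor [1 + 1/l] at least double a ball. *)
Lemma expn_succ_ge2 l : 0 < l -> 2 * l ^ l <= l.+1 ^ l.
Proof.
case: l => [|l] // _.
rewrite -[in X in _ <= X]addn1 expnDn big_ord_recl big_ord_recl /= /bump /= add1n.
rewrite subn0 subSS subn0 bin0 bin1 expn0 expn1 !muln1 mul1n expnS mul2n -addnn addnA.
exact: leq_addr.
Qed.

(* Otherwise the balls grow by a factor greater than 1 + 1/l at each step. *)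
Lemma ball_sparse_layer (R : {set T}) v l p : 0 < l -> #|ball R v (l * p)| < 2 ^ p ->
  exists2 j, j < l * p &
    l * #|ball R v j.+1 :\: ball R v j| <= #|ball R v j|.
Proof.
move=> l0 small.
case: (boolP [exists j : 'I_(l * p),
  l * #|ball R v j.+1 :\: ball R v j| <= #|ball R v j|]).
  by case/existsP => j hj; exists j.
move/existsPn => big; exfalso.
have grow j : j <= l * p -> l.+1 ^ j <= l ^ j * #|ball R v j|.
  elim: j => [|j IH] jlt; first by rewrite cards1.
  have := big (Ordinal jlt); rewrite -ltnNge [nat_of_ord _]/= => bj.
  have {}IH := IH (ltnW jlt).
  rewrite -(cardsID (ball R v j) (ball R v j.+1)) (setIidPr (ballS R v j)).
  rewrite !expnS -mulnA.
  have := leq_mul (leqnn l.+1) IH; move/leq_trans; apply.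
  rewrite mulnCA (mulnCA l) leq_mul2l; apply/orP; right.
  by rewrite mulnDr mulSn addnC leq_add2l ltnW.
have := grow _ (leqnn _).
rewrite !expnM.
have := @leq_exp2r (2 * l ^ l) (l.+1 ^ l).
(* [leq_exp2r] needs a positive exponent; for [p = 0] the ball would be empty, yet it contains its
   centre. *)
case: p small big grow => [|p] small big grow.
  by have := ball_center R v (l * 0); rewrite (cards0_eq (A := ball R v (l * 0))) ?inE //; lia.
move=> /(_ p.+1 isT); rewrite expn_succ_ge2 // expnMn => up low.
have := leq_trans up low.
rewrite mulnC leq_pmul2l ?expn_gt0 ?expn_gt0 ?l0 //.
by rewrite leqNgt small.
Qed.

(** [Y] and [Z] stand for consecutive balls: discarding the layer [Z :\: Y], paid for by [Y],
    separates [Y] from the rest of [R]. *)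
Definition sparse_cut l (R Y Z : {set T}) : Prop :=
  [/\ Y \subset Z, Z \subset R, Y != set0, 2 * #|Y| <= #|R|
    & l * #|Z :\: Y| <= #|Y|] /\
  (forall x y, x \in Y -> y \in R :\: Z -> ~~ e x y).

Lemma small_ball_cut l p (R : {set T}) v : 0 < l -> v \in R -> #|R| < 2 ^ p ->
  2 * #|ball R v (l * p)| <= #|R| -> exists Y Z, sparse_cut l R Y Z.
Proof.
move=> l0 vR Rp small.
have [|j jlt hj] := @ball_sparse_layer R v l p l0; first by lia.
exists (ball R v j), (ball R v j.+1); split; first split=> //.
- exact: ballS.
- exact: ball_sub.
- by apply/set0Pn; exists v; apply: ball_center.
- apply: leq_trans small; rewrite leq_pmul2l //.
  exact/subset_leq_card/ball_mono/ltnW.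
move=> x y xb /setDP[yR]; apply: contra => exy; exact: ball_nbr exy.
Qed.

(* If the two balls are disjoint, one of them contains at most half of R. *)
Lemma link_or_cut l p (R : {set T}) v w : 0 < l -> v \in R -> w \in R -> #|R| < 2 ^ p ->
  (exists X : {set T}, [/\ v \in X, w \in X, X \subset R, conn X
     & #|X| <= 2 * (l * p).+1]) \/
  exists Y Z, sparse_cut l R Y Z.
Proof.
move=> l0 vR wR Rp.
case: (boolP [disjoint ball R v (l * p) & ball R w (l * p)]) => [dis|].
  right.
  have := subset_leq_card (_ : ball R v (l * p) :|: ball R w (l * p) \subset R).
  rewrite subUset !ball_sub // => /(_ isT).
  rewrite cardsU disjoint_setI0 // cards0 subn0 => le.
  case: (leqP (2 * #|ball R v (l * p)|) #|R|) => hv.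
    exact: small_ball_cut hv.
  by apply: (@small_ball_cut l p R w) => //; lia.
rewrite -setI_eq0 => /set0Pn[z /setIP[zv zw]]; left.
have [X [vX zX sX cX leX]] := ball_path vR zv.
have [Y [wY zY sY cY leY]] := ball_path wR zw.
exists (X :|: Y); split.
- by rewrite inE vX.
- by rewrite inE wY orbT.
- by rewrite subUset sX.
- exact: connU zX zY.
- by rewrite cardsU; lia.
Qed.

(** Links from the root [v] to the targets are glued at [v]. With one target adjacent to each
    current branch set, the resulting tree is a new branch set touching all of them. *)
Lemma tree_or_cut l p (R : {set T}) v (ws : seq T) : 0 < l -> v \in R ->
  {subset ws <= R} -> #|R| < 2 ^ p ->
  (exists X : {set T}, [/\ v \in X, {subset ws <= X}, X \subset R, conn X
     & #|X| <= 1 + size ws * (2 * (l * p).+1)]) \/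
  exists Y Z, sparse_cut l R Y Z.
Proof.
move=> l0 vR + Rp; elim: ws => [|w ws IH] sws.
  left; exists [set v]; rewrite set11 sub1set cards1; split=> //; exact: conn1.
have [|[X [vX wsX sX cX leX]]|cut] := IH _; last by right.
  by move=> x xws; apply: sws; rewrite inE xws orbT.
have wR : w \in R by apply: sws; rewrite mem_head.
have [[Y [vY wY sY cY leY]]|cut] := link_or_cut l0 vR wR Rp; last by right.
left; exists (X :|: Y); split.
- by rewrite inE vX.
- by move=> x; rewrite !inE => /orP[/eqP->|/wsX->]; rewrite ?wY ?orbT.
- by rewrite subUset sX.
- exact: connU vX vY.
- by rewrite cardsU /= mulSn; lia.
Qed.

(** A minor model of a complete graph, kept as a list because the separator argument adds and drops
    branch sets one at a time. *)
Definition clique_model (Bs : seq {set T}) : Prop :=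
  [/\ {in Bs, forall B : {set T}, B != set0}, {in Bs, forall B, conn B}
    & pairwise (fun X Y : {set T} => [disjoint X & Y] && touch X Y) Bs].

Lemma clique_model_subseq Bs Bs' :
  subseq Bs' Bs -> clique_model Bs -> clique_model Bs'.
Proof.
move=> sub [ne cn pw]; split.
- by move=> B /(mem_subseq sub)/ne.
- by move=> B /(mem_subseq sub)/cn.
- exact: subseq_pairwise sub pw.
Qed.

Definition bunion (Bs : seq {set T}) : {set T} := \bigcup_(B <- Bs) B.

Lemma bunion_cons B Bs : bunion (B :: Bs) = B :|: bunion Bs.
Proof. by rewrite /bunion big_cons. Qed.

Lemma bunionP (Bs : seq {set T}) x : reflect (exists2 B, B \in Bs & x \in B) (x \in bunion Bs).
Proof.
elim: Bs => [|B Bs IH]; first by rewrite /bunion big_nil inE; constructor => -[].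
rewrite bunion_cons inE; apply: (iffP orP) => [[xB|/IH[C CB xC]]|[C]].
- by exists B; rewrite ?mem_head.
- by exists C => //; rewrite inE CB orbT.
- by rewrite inE => /orP[/eqP->|CB] xC; [left|right; apply/IH; exists C].
Qed.

Lemma card_bunion s (Bs : seq {set T}) :
  {in Bs, forall B : {set T}, #|B| <= s} -> #|bunion Bs| <= size Bs * s.
Proof.
elim: Bs => [|B Bs IH] h; first by rewrite /bunion big_nil cards0.
rewrite bunion_cons cardsU /=.
have := IH (fun C CB => h C (mem_behead (s := B :: Bs) CB)).
have := h B (mem_head _ _); rewrite mulSn; lia.
Qed.

Lemma touching_targets (R : {set T}) (Bs : seq {set T}) :
  {in Bs, forall B, touch B R} ->
  exists ws : seq T, [/\ size ws = size Bs, {subset ws <= R}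
    & {in Bs, forall B : {set T}, exists x y, [/\ x \in B, y \in ws & e x y]}].
Proof.
elim: Bs => [|B Bs IH] tch; first by exists [::].
have [|ws [sz sub tg]] := IH; first by move=> C CB; apply: tch; rewrite inE CB orbT.
have /touchP[x [y [xB yR exy]]] := tch B (mem_head _ _).
exists (y :: ws); split => /=; first by rewrite sz.
  by move=> z; rewrite inE => /orP[/eqP->|/sub].
move=> C; rewrite inE => /orP[/eqP->|/tg[x' [y' [? ? ?]]]].
  by exists x, y; rewrite mem_head.
by exists x', y'; rewrite inE; split=> //; apply/orP; right.
Qed.

Definition separated (A R : {set T}) := forall x y, x \in A -> y \in R -> ~~ e x y.

(* A is the part already cut off, R the part still to be split, and the branch
   sets Bs are set aside; whatever else of C was discarded is charged to A. *)
Definition prs_state l s (C A R : {set T}) (Bs : seq {set T}) : Prop :=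
  [/\ clique_model Bs, {in Bs, forall B : {set T}, #|B| <= s},
      [disjoint R & A] && [disjoint R & bunion Bs],
      [&& A \subset C, R \subset C & bunion Bs \subset C] &
   [/\ separated A R, 3 * #|A| <= 2 * #|C|
    & l * #|C :\: (A :|: R :|: bunion Bs)| <= #|A|]].

(** While [R] is too large, one of three moves applies: a branch set not touching [R] joins [A]; a
    tree in [R] becomes a branch set; or a sparse cut moves a piece of [R] to [A]. There are always
    fewer than [h] branch sets, so discarding them at the end costs at most [h * s] vertices. *)
Lemma prs_separator h l p (C : {set T}) (s := h * (2 * (l * p).+1) + 1) :
  (forall Bs, size Bs = h -> ~ clique_model Bs) -> 0 < l -> #|C| < 2 ^ p ->
  3 * s <= #|C| ->
  exists A R : {set T},
    [/\ A \subset C, R \subset C & [disjoint R & A]] /\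
    [/\ separated A R, 3 * #|A| <= 2 * #|C|, 3 * #|R| <= 2 * #|C|
      & l * #|C :\: (A :|: R)| <= #|C| + l * (h * s)].
Proof.
move=> noK l0 Cp sC.
have szBs Bs : clique_model Bs -> size Bs < h.
  move=> mBs; rewrite ltnNge; apply/negP => le.
  apply: (noK (take h Bs)); first by rewrite size_takel.
  exact: clique_model_subseq (take_subseq _ _) mBs.
(* The weight 2 makes the measure drop also when a tree leaves [R] and lengthens [Bs] by one. *)
suff main N (A R : {set T}) (Bs : seq {set T}) :
    2 * #|R| + size Bs < N -> prs_state l s C A R Bs ->
    exists A R : {set T},
    [/\ A \subset C, R \subset C & [disjoint R & A]] /\
    [/\ separated A R, 3 * #|A| <= 2 * #|C|, 3 * #|R| <= 2 * #|C|
      & l * #|C :\: (A :|: R)| <= #|C| + l * (h * s)].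
  apply: (main _ set0 C [::] (ltnSn _)).
  rewrite /prs_state /bunion big_nil !sub0set subxx -!setI_eq0 !setI0 eqxx !cards0 !muln0.
  split=> //; split=> //.
    by move=> x y; rewrite inE.
  by rewrite !setU0 set0U setDv cards0 muln0.
elim: N A R Bs => [|N IH] A R Bs //.
rewrite ltnS => leN [mBs sBs /andP[dRA dRB] /and3P[sA sR sB] [sep leA leZ]].
have cAR : #|A :|: R| = #|A| + #|R|.
  by rewrite cardsU setIC disjoint_setI0 // cards0 subn0.
have leAR : #|A| + #|R| <= #|C|.
  by rewrite -cAR; apply: subset_leq_card; rewrite subUset sA.
have [Rsmall|Rbig] := leqP (3 * #|R|) (2 * #|C|).
  exists A, R; split; split=> //.
  apply: leq_trans (_ : l * (#|C :\: (A :|: R :|: bunion Bs)| + #|bunion Bs|) <= _).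
    rewrite leq_mul2l; apply/orP; right.
    apply: leq_trans (leq_card_setU _ _); apply/subset_leq_card/subsetP => x.
    by rewrite !inE; case: (x \in bunion _); rewrite ?orbT ?orbF.
  rewrite mulnDr; apply: leq_add.
    by apply: leq_trans leZ _; lia.
  rewrite leq_mul2l; apply/orP; right; apply: leq_trans (card_bunion sBs) _.
  by rewrite leq_mul2r (ltnW (szBs _ mBs)) orbT.
(* Since [R] exceeds two thirds of [C], [A] is below one third; a branch set has at most [s]
   vertices, at most another third, so [A] may absorb it. *)
have [/allP tch|/allPn[B BBs ntch]] := boolP (all (touch ^~ R) Bs); last first.
  have [/= sB1 sB2] : B \subset bunion Bs /\ bunion (rem B Bs) \subset bunion Bs.
    split; apply/subsetP => x; first by move=> xB; apply/bunionP; exists B.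
    by case/bunionP => D /mem_rem DB xD; apply/bunionP; exists D.
  apply: (IH (A :|: B) R (rem B Bs)).
    by rewrite size_rem //; move: BBs leN; case: (Bs) => //= *; lia.
  split=> //.
  - exact: clique_model_subseq (rem_subseq _ _) mBs.
  - by move=> D /mem_rem/sBs.
  - rewrite disjoints_subset setCU subsetI -!disjoints_subset dRA.
    rewrite !(disjointWr _ dRB) //.
  - by rewrite subUset sA sR !(subset_trans _ sB).
  split.
  - move=> x y /setUP[xA|xB] yR; first exact: sep.
    by apply: contra ntch => exy; apply/touchP; exists x, y.
  - apply: leq_trans (_ : 3 * (#|A| + #|B|) <= _).
      by rewrite leq_mul2l leq_card_setU orbT.
    by have := sBs B BBs; lia.
  apply: leq_trans (leq_trans leZ (subset_leq_card (subsetUl _ _))).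
  rewrite leq_mul2l; apply/orP; right; apply/subset_leq_card/subsetP => x.
  rewrite !inE !negb_or -!andbA => /and5P[-> nB -> nBs ->]; rewrite !andbT /=.
  apply/bunionP => -[D DB xD].
  have [DeB|neDB] := eqVneq D B; first by rewrite -DeB xD in nB.
  move/bunionP: nBs; apply; exists D => //.
  move: DB; rewrite (perm_mem (perm_to_rem BBs)) inE (negbTE neDB) //.
have [ws [szws sws tws]] := touching_targets tch.
have [v vR] : exists v, v \in R by apply/set0Pn; rewrite -card_gt0; lia.
have Rp : #|R| < 2 ^ p by apply: leq_ltn_trans Cp; apply: subset_leq_card.
have [[X [vX wsX sX cX leX]]|[Y [Z [[sYZ sZ Y0 Yhalf Zsp] sepYZ]]]] :=
  tree_or_cut l0 vR sws Rp.
  (* Tree case: fewer than [h] targets keep the size of [X] within [s]. *)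
  have cRX : #|R :\: X| + #|X| = #|R|.
    by rewrite -(cardsID X R) (setIidPr sX) addnC.
  have X0 : 0 < #|X| by rewrite card_gt0; apply/set0Pn; exists v.
  apply: (IH A (R :\: X) (X :: Bs)); first by rewrite /=; lia.
  have dXB : [disjoint X & bunion Bs] by apply: disjointWl dRB.
  split=> //.
  - case: mBs => ne cn pw; split=> /=.
    + by move=> B; rewrite inE => /orP[/eqP->|/ne//]; apply/set0Pn; exists v.
    + by move=> B; rewrite inE => /orP[/eqP->|/cn].
    rewrite pw andbT; apply/allP => B BBs; apply/andP; split.
      apply: disjointWr dXB; apply/subsetP => x xB; apply/bunionP.
      by exists B.
    have [x [y [xB /wsX yX exy]]] := tws B BBs.
    by apply/touchP; exists y, x; rewrite e_sym.
  - move=> B; rewrite inE => /orP[/eqP->|/sBs//].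
    apply: leq_trans leX _; rewrite addnC leq_add2r szws leq_mul2r.
    by rewrite (ltnW (szBs _ mBs)) orbT.
  - rewrite (disjointWl (subsetDl _ _) dRA) /= bunion_cons.
    rewrite disjoints_subset setCU subsetI -!disjoints_subset.
    rewrite (disjointWl (subsetDl _ _) dRB) andbT.
    by rewrite disjoints_subset subsetDr.
  - rewrite sA (subset_trans (subsetDl _ _) sR) bunion_cons subUset sB andbT.
    exact: subset_trans sX sR.
  split=> //; first by move=> x y xA /setDP[yR _]; apply: sep.
  apply: leq_trans leZ; rewrite leq_mul2l; apply/orP; right.
  apply/subset_leq_card/subsetP => x; rewrite bunion_cons !inE.
  by case: (x \in X); rewrite ?orbT.
(* Cut case: [Y] is at most half of [R], so [A :|: Y] has at most [#|C| - #|R| / 2] vertices, less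
   than two thirds of [#|C|]. *)
have Ylt : 0 < #|Y| by rewrite card_gt0.
have YR : Y \subset R := subset_trans sYZ sZ.
have cRZ : #|R :\: Z| + #|Z| = #|R| by rewrite -(cardsID Z R) (setIidPr sZ) addnC.
have YZ : #|Y| <= #|Z| by apply: subset_leq_card.
have cAY : #|A :|: Y| = #|A| + #|Y|.
  by rewrite cardsU setIC disjoint_setI0 ?cards0 ?subn0 //; apply: disjointWl dRA.
apply: (IH (A :|: Y) (R :\: Z) Bs); first by lia.
split=> //.
- rewrite (disjointWl (subsetDl _ _) dRB) andbT.
  rewrite disjoints_subset setCU subsetI -!disjoints_subset.
  rewrite (disjointWl (subsetDl _ _) dRA) /=.
  by rewrite (disjointWr sYZ) // disjoints_subset subsetDr.
- by rewrite subUset sA (subset_trans YR sR) (subset_trans (subsetDl _ _) sR).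
split.
- move=> x y /setUP[xA|xY] yR; last exact: sepYZ.
  by case/setDP: yR => yR _; apply: sep.
- by rewrite cAY; lia.
rewrite cAY; apply: leq_trans (leq_add leZ Zsp).
rewrite -mulnDr leq_mul2l; apply/orP; right.
apply: leq_trans (leq_card_setU _ _); apply/subset_leq_card/subsetP => x.
rewrite !inE; case: (x \in A); case: (x \in Y); case: (x \in Z); case: (x \in R);
 case: (x \in bunion _); case: (x \in C) => //.
Qed.

End Separator.

(** * Hyperfiniteness *)

Lemma quintic_le_geometric : exists2 K, 0 < K & forall j, (j + 3) ^ 5 * 2 ^ j <= K * 3 ^ j.
Proof.
(* Up to [j = 9] the base [j + 3] is at most 12. From then on induction works because
   [(13/12)^5 < 3/2]. *)
exists (12 ^ 5); first by rewrite expn_gt0.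
move=> j; have [small|big] := leqP j 9.
  by apply: leq_mul; [rewrite leq_exp2r //; lia|case: j small => // j _; rewrite leq_exp2r].
rewrite -(subnK (ltnW big)); elim: (j - 9) => [|i IH].
  by apply: leq_mul; [|rewrite leq_exp2r].
have step : (i.+1 + 9 + 3) ^ 5 * 2 <= 3 * (i + 9 + 3) ^ 5.
  rewrite !expnS !expn0 !muln1; nia.
rewrite [2 ^ (i.+1 + 9)]expnS [3 ^ (i.+1 + 9)]expnS mulnA (mulnCA (12 ^ 5)).
apply: leq_trans (leq_mul step (leqnn (2 ^ (i + 9)))) _.
by rewrite -mulnA leq_mul2l IH orbT.
Qed.

Section Hyperfinite.
Variables (T : finType) (e : rel T).
Hypothesis e_sym : symmetric e.

(* The values of Q are meant as blocks, but they need not partition T: two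
   vertices lie in the same block when Q takes the same value at both. *)
Definition fragmented k (C S : {set T}) (Q : T -> {set T}) : Prop :=
  [/\ forall u, u \in Q u, forall u, #|Q u| <= k
    & {in C :\: S &, forall u v, e u v -> Q u = Q v}].

Lemma fragmented_join k (C A R S1 S2 : {set T}) Q1 Q2 :
  [disjoint R & A] -> separated e A R ->
  fragmented k A S1 Q1 -> fragmented k R S2 Q2 ->
  fragmented k C (C :\: (A :|: R) :|: (S1 :|: S2))
    (fun u => if u \in A then Q1 u else Q2 u).
Proof.
move=> dRA sep [q1 c1 f1] [q2 c2 f2]; split=> [u|u|u v]; try by case: ifP.
rewrite !inE !negb_or !negb_and !negbK => /andP[/and3P[uAR u1 u2] uC].
move=> /andP[/and3P[vAR v1 v2] vC] euv; move: uAR vAR; rewrite uC vC !orbF.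
case: (boolP (u \in A)) => uA; case: (boolP (v \in A)) => vA /=.
- by move=> _ _; apply: f1; rewrite ?inE ?u1 ?v1.
- by move=> _ vR; have := sep _ _ uA vR; rewrite euv.
- by move=> uR; have := sep _ _ vA uR; rewrite e_sym euv.
- by move=> uR vR; apply: f2; rewrite ?inE ?u2 ?v2.
Qed.

Variables (h K l0 q : nat).
Hypothesis noK : forall Bs, size Bs = h -> ~ clique_model e Bs.
Hypothesis quinticK : forall j, (j + 3) ^ 5 * 2 ^ j <= K * 3 ^ j.
Hypothesis l0_ge2 : 1 < l0.
Hypothesis q_big : 2 * h.+1 ^ 2 * l0 ^ 2 * K * q.+1 <= 2 ^ q.

(** Both bounds are at most of order [h^2 l^2 p], where [l^2] contributes [(j+3)^4] and [p] one more
    factor [j+3]. The geometric growth of [m] beats this fifth power through [quinticK], and [q_big]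
    absorbs the constants. *)
Lemma level_arith j m (l := l0 * (j.+1 * j.+2)) (p := q + j.+2)
    (s := h * (2 * (l * p).+1) + 1) :
  2 ^ q * 3 ^ j < 2 ^ j * m -> l * (h * s) <= m /\ 3 * s <= m.
Proof.
move=> mbig.
have l4 : 4 <= l by rewrite /l -[4]/(2 * (1 * 2)); apply: leq_mul => //; apply: leq_mul.
have sle : s <= h.+1 * (2 * (l * p.+1)).
  rewrite /s mulSn; nia.
have big : 2 * h.+1 ^ 2 * l ^ 2 * p.+1 <= m.
  suff : 2 ^ j * (2 * h.+1 ^ 2 * l ^ 2 * p.+1) <= 2 ^ q * 3 ^ j.
    move=> le; have := leq_ltn_trans le mbig; rewrite ltn_pmul2l ?expn_gt0 //; exact: ltnW.
  have lle : l ^ 2 <= l0 ^ 2 * (j + 3) ^ 4.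
    rewrite (expnM (j + 3) 2 2) -expnMn leq_exp2r // leq_mul2l; apply/orP; right.
    rewrite expnS expn1; apply: leq_mul; lia.
  have ple : p.+1 <= q.+1 * (j + 3) by rewrite /p; nia.
  apply: leq_trans (_ : 2 * h.+1 ^ 2 * l0 ^ 2 * q.+1 * ((j + 3) ^ 5 * 2 ^ j) <= _).
    have := leq_mul lle ple; rewrite (expnSr (j + 3) 4).
    move: ((j + 3) ^ 4) (h.+1 ^ 2) (l ^ 2) (l0 ^ 2) (2 ^ j) => a b c d f hh.
    have -> : f * (2 * b * c * p.+1) = (2 * b * f) * (c * p.+1) by nia.
    have -> : 2 * b * d * q.+1 * (a * (j + 3) * f) =
        (2 * b * f) * (d * a * (q.+1 * (j + 3))) by nia.
    by rewrite leq_mul2l hh orbT.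
  apply: leq_trans (leq_mul (leqnn _) (quinticK j)) _.
  by rewrite mulnA leq_mul2r -mulnA (mulnC q.+1) mulnA q_big orbT.
split; apply: leq_trans big.
  apply: leq_trans (_ : l * (h.+1 * (h.+1 * (2 * (l * p.+1)))) <= _).
    by rewrite leq_mul2l leq_mul ?orbT.
  by rewrite !expnS !expn0 !muln1; nia.
apply: leq_trans (leq_mul (leqnn 3) sle) _.
have : 3 * (h.+1 * (2 * (l * p.+1))) <= l * (h.+1 * (2 * (l * p.+1))).
  by rewrite leq_mul2r; apply/orP; right; lia.
move/leq_trans; apply; rewrite !expnS !expn0 !muln1; nia.
Qed.

(** The allowed fraction [2j / (l0 (j+1))] is the telescoped sum of the separator costs
    [2 / (l0 (i+1)(i+2))] over [i < j]. *)
Lemma hyperfinite_level j (C : {set T}) : 2 ^ j * #|C| <= 2 ^ q * 3 ^ j ->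
  exists S Q, fragmented (2 ^ q) C S Q /\ l0 * j.+1 * #|S| <= 2 * j * #|C|.
Proof.
elim: j C => [|j IH] C.
  rewrite !expn0 mul1n muln1 => small.
  exists set0, (fun u => if u \in C then C else [set u]); split; last by rewrite cards0 muln0.
  split=> [u|u|u v]; first by case: ifP => // _; rewrite set11.
    by case: ifP => // _; rewrite cards1 expn_gt0.
  by rewrite !inE /= => -> ->.
move=> leC; have [small|big] := leqP (2 ^ j * #|C|) (2 ^ q * 3 ^ j).
  have [S [Q [fQ leS]]] := IH C small; exists S, Q; split=> //.
  rewrite -(leq_pmul2l (ltn0Sn j)).
  move: leS; move: #|S| #|C| => a b; nia.
have [hs1 hs2] := level_arith big.
set l := l0 * (j.+1 * j.+2) in hs1 hs2; set p := q + j.+2 in hs1 hs2.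
have Cp : #|C| < 2 ^ p.
  apply: leq_ltn_trans (_ : 2 ^ (q + j.+1) < _); last by rewrite ltn_exp2l // /p ltn_add2l.
  rewrite -(leq_pmul2l (_ : 0 < 2 ^ j.+1)) ?expn_gt0 //; apply: leq_trans leC _.
  rewrite expnD mulnCA leq_mul2l -expnMn leq_exp2r // orbT //.
have l_gt0 : 0 < l by rewrite /l !muln_gt0; lia.
have [A [R [[sA sR dRA] [sep leA leR leZ]]]] := prs_separator e_sym noK l_gt0 Cp hs2.
(* Shrinking to two thirds lowers the level by one. *)
have down (X : {set T}) : 3 * #|X| <= 2 * #|C| -> 2 ^ j * #|X| <= 2 ^ q * 3 ^ j.
  move=> leX; rewrite -(leq_pmul2l (_ : 0 < 3)) // mulnCA.
  apply: leq_trans (leq_mul (leqnn _) leX) _.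
  by move: leC; rewrite !expnS; move: (2 ^ j) (2 ^ q) (3 ^ j) #|C|; nia.
have [S1 [Q1 [f1 le1]]] := IH A (down A leA).
have [S2 [Q2 [f2 le2]]] := IH R (down R leR).
exists (C :\: (A :|: R) :|: (S1 :|: S2)), (fun u => if u \in A then Q1 u else Q2 u).
split; first exact: fragmented_join.
have leAR : #|A| + #|R| <= #|C|.
  have : #|A :|: R| <= #|C| by apply: subset_leq_card; rewrite subUset sA.
  by rewrite cardsU setIC disjoint_setI0 // cards0 subn0.
have leS := leq_trans (leq_card_setU (C :\: (A :|: R)) (S1 :|: S2))
  (leq_add (leqnn _) (leq_card_setU S1 S2)).
move: leS leZ le1 le2 hs1 leAR.
move: #|_ :|: (_ :|: _)| #|C :\: _| #|S1| #|S2| #|A| #|R| #|C| (l * (h * _)).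
rewrite /l => s z s1 s2 a r c x leS leZ le1 le2 hs1 leAR.
(* The separator costs [2c] and the two sides [2j(j+2)c] after scaling; [1 + j(j+2) = (j+1)^2]
   closes the induction. *)
rewrite -(leq_pmul2l (ltn0Sn j)).
have t1 : l0 * (j.+1 * j.+2) * s <= l0 * (j.+1 * j.+2) * (z + (s1 + s2)).
  by rewrite leq_mul2l leS orbT.
have t2 : j.+2 * (l0 * j.+1 * s1) <= j.+2 * (2 * j * a) by rewrite leq_mul2l le1 orbT.
have t3 : j.+2 * (l0 * j.+1 * s2) <= j.+2 * (2 * j * r) by rewrite leq_mul2l le2 orbT.
have t4 : j.+2 * (2 * j * (a + r)) <= j.+2 * (2 * j * c) by rewrite !leq_mul2l leAR !orbT.
nia.
Qed.

Lemma hyperfinite :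
  exists S Q, fragmented (2 ^ q) setT S Q /\ l0 * #|S| <= 2 * #|T|.
Proof.
(* Level [2m] admits a set of [m] vertices, since [4^m m <= 8^m <= 9^m]; the factor [2j/(j+1)] is
   below 2 at every level. *)
have [|S [Q [fQ leS]]] := @hyperfinite_level (2 * #|T|) setT.
  apply: leq_trans (_ : 3 ^ (2 * #|T|) <= _); last by rewrite leq_pmull ?expn_gt0.
  rewrite cardsT !expnM; apply: leq_trans (_ : (2 ^ 2) ^ #|T| * 2 ^ #|T| <= _).
    by rewrite leq_mul2l (ltnW (ltn_expl _ _)) ?orbT.
  by rewrite -expnMn; case: #|T| => // c; rewrite leq_exp2r.
exists S, Q; split=> //; move: leS; rewrite cardsT.
move: #|S| #|T| => a b leS.
rewrite -(leq_pmul2l (ltn0Sn (2 * b))); nia.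
Qed.

End Hyperfinite.

(** A complete graph on [h] vertices contains every graph on [h] vertices, so its model serves as a
    model of [H]. *)
Lemma no_clique_model h (H : sgraph h) n (G : sgraph n) Bs :
  ~ minor H G -> size Bs = h -> ~ clique_model G Bs.
Proof.
move=> noH szB [ne cn pw]; apply: noH; exists (fun x => nth set0 Bs x).
have inB (x : 'I_h) : nth set0 Bs x \in Bs by rewrite mem_nth // szB.
have pwB (x y : 'I_h) : x != y ->
    [disjoint nth set0 Bs x & nth set0 Bs y] && touch G (nth set0 Bs x) (nth set0 Bs y).
  rewrite neq_ltn; move/pairwiseP: pw => pw /orP[lt|lt].
    by apply: pw; rewrite // inE szB.
  have /andP[dis /touchP[u [v [uB vB Guv]]]] :=
    pw set0 y x (etrans (congr1 _ szB) (ltn_ord y)) (etrans (congr1 _ szB) (ltn_ord x)) lt.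
  rewrite disjoint_sym dis; apply/touchP; exists v, u; split=> //; by rewrite adj_sym.
split.
- by move=> x; apply: ne.
- by move=> x; apply: cn.
- by move=> x y /pwB/andP[].
- move=> x y Hxy; have : x != y by apply: contraTneq Hxy => ->; rewrite adj_irr.
  by move/pwB/andP => [_ /touchP].
Qed.

Local Open Scope ring_scope.

(** * Walks confined to blocks *)

Section SymmetricSubstochastic.
Variables (R : realType) (n : nat) (N : 'M[R]_n).
Hypothesis N_ge0 : forall u v, 0 <= N u v.
Hypothesis N_sym : forall u v, N u v = N v u.
Hypothesis N_row : forall u, \sum_v N u v <= 1.
Hypothesis N_diag : forall u, 2^-1 <= N u u.

Lemma mxpowS t u v : (N ^+ t.+1) u v = \sum_w N u w * (N ^+ t) w v.
Proof. by rewrite exprS -mulmxE mxE. Qed.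

Lemma mxpow_ge0 t u v : 0 <= (N ^+ t) u v.
Proof.
elim: t u v => [|t IH] u v; first by rewrite expr0 -idmxE mxE ler0n.
by rewrite mxpowS sumr_ge0 // => w _; rewrite mulr_ge0.
Qed.

Lemma mxpow_sym t u v : (N ^+ t) u v = (N ^+ t) v u.
Proof.
elim: t u v => [|t IH] u v; first by rewrite expr0 -!idmxE !mxE eq_sym.
rewrite mxpowS exprSr -mulmxE mxE; apply: eq_bigr => w _.
by rewrite mulrC N_sym IH.
Qed.

(** The vector [N^t f] for the indicator [f] of [F]. *)
Definition occupation (F : {set 'I_n}) t u : R := \sum_(s in F) (N ^+ t) u s.

Lemma occupation0 (F : {set 'I_n}) u : occupation F 0 u = (u \in F)%:R.
Proof.
rewrite /occupation expr0 -idmxE; case: (boolP (u \in F)) => uF.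
  rewrite (bigD1 u) //= mxE eqxx big1 ?addr0 // => s /andP[_ su].
  by rewrite mxE eq_sym (negbTE su).
rewrite big1 // => s sF; rewrite mxE; case: eqP => // us.
by rewrite us sF in uF.
Qed.

Lemma occupationS F t u : occupation F t.+1 u = \sum_v N u v * occupation F t v.
Proof.
rewrite /occupation; under eq_bigr do rewrite mxpowS.
by rewrite exchange_big /=; apply: eq_bigr => v _; rewrite mulr_sumr.
Qed.

Lemma occupation_ge0 F t u : 0 <= occupation F t u.
Proof. by apply: sumr_ge0 => s _; apply: mxpow_ge0. Qed.

Lemma occupation_le1 F t u : occupation F t u <= 1.
Proof.
elim: t u => [|t IH] u; first by rewrite occupation0 lern1 leq_b1.
rewrite occupationS; apply: le_trans (N_row u); apply: ler_sum => v _.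
by rewrite ler_piMr.
Qed.

(** By symmetry, one step loses at [v] its row deficit times its occupation, which is at most 1. *)
Lemma occupation_mass (F : {set 'I_n}) t :
  #|F|%:R - t%:R * \sum_u (1 - \sum_v N u v) <= \sum_u occupation F t u.
Proof.
elim: t => [|t IH].
  rewrite mul0r subr0 (eq_bigr _ (fun u _ => occupation0 F u)) -natr_sum.
  by rewrite ler_nat -sum1_card big_mkcond /=; apply: leq_sum => u _; case: (_ \in _).
have step : \sum_u occupation F t u - \sum_u (1 - \sum_v N u v) <=
    \sum_u occupation F t.+1 u.
  under [X in _ <= X]eq_bigr do rewrite occupationS.
  rewrite [X in _ <= X]exchange_big /= -sumrB; apply: ler_sum => v _.
  under [X in _ <= X]eq_bigr do rewrite N_sym.
  rewrite -mulr_suml.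
  have := N_row v; have := occupation_le1 F t v; nra.
by rewrite -natr1 mulrDl mul1r; lra.
Qed.

Lemma return_massD (F : {set 'I_n}) k m :
  \sum_(u in F) occupation F (k + m) u = \sum_v occupation F k v * occupation F m v.
Proof.
rewrite /occupation; under eq_bigr => u _.
  under eq_bigr => s _ do rewrite exprD -mulmxE mxE.
  rewrite exchange_big /=; under eq_bigr => v _ do rewrite -mulr_sumr mxpow_sym.
  over.
by rewrite exchange_big /=; apply: eq_bigr => v _; rewrite mulr_suml.
Qed.

(** By symmetry, an even time gives exactly the squared norm at half time. An odd time has one extra
    step, of which the diagonal keeps at least half. *)
Lemma return_mass_half (F : {set 'I_n}) t :
  2^-1 * \sum_u occupation F t./2 u ^+ 2 <= \sum_(u in F) occupation F t u.
Proof.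
rewrite -{2}(odd_double_half t) -addnn addnCA return_massD mulr_sumr.
apply: ler_sum => v _; have := occupation_ge0 F t./2 v.
case: odd => o0; last by rewrite add0n; nra.
rewrite add1n occupationS (bigD1 v) //=.
have := N_diag v.
have : 0 <= \sum_(w < n | w != v) N v w * occupation F t./2 w.
  by apply: sumr_ge0 => w _; rewrite mulr_ge0 ?occupation_ge0.
nra.
Qed.

Lemma return_mass_ge (F : {set 'I_n}) t (m : R) : (0 < n)%N -> 0 <= m ->
  m <= \sum_u occupation F t./2 u ->
  m ^+ 2 / n%:R / 2 <= \sum_(u in F) occupation F t u.
Proof.
move=> n0 m0 le; apply: le_trans (return_mass_half F t).
have nR : 0 < n%:R :> R by rewrite ltr0n.
rewrite [m ^+ 2 / n%:R / 2]mulrC ler_pM2l ?invr_gt0 ?ltr0n //.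
(* Cauchy-Schwarz by the tangent bound [x^2 >= 2 a x - a^2] at the mean [a]. *)
set a := m / n%:R.
have a0 : 0 <= a by rewrite divr_ge0 // ltW.
have aE : a * n%:R = m by rewrite divfK // gt_eqF.
apply: le_trans (_ : \sum_u (2 * a * occupation F t./2 u - a ^+ 2) <= _); last first.
  apply: ler_sum => u _; have := sqr_ge0 (a - occupation F t./2 u); nra.
rewrite sumrB -mulr_sumr sumr_const card_ord -[a ^+ 2 *+ n]mulr_natr.
have -> : m ^+ 2 / n%:R = a * m by rewrite expr2 -mulrA mulrC.
have := ler_wpM2l a0 le; nra.
Qed.

End SymmetricSubstochastic.

(** * The walk matrix and its restriction to blocks *)

Section WalkMatrix.
Variables (R : realType) (d n : nat) (G : sgraph n).
Hypothesis d_gt0 : (0 < d)%N.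
Hypothesis deg_le : forall v, (deg G v <= d)%N.

Local Notation M := (walk_mx R d G).
Local Notation step := ((2 * d%:R)^-1 : R).

Lemma step_ge0 : 0 <= step.
Proof. by rewrite invr_ge0 mulr_ge0 ?ler0n. Qed.

Lemma deg_step u : (deg G u)%:R * step <= 2^-1.
Proof.
have d0 : 0 < d%:R :> R by rewrite ltr0n.
rewrite ler_pdivrMr ?mulr_gt0 // mulrA mulVf ?mul1r ?ler_nat ?pnatr_eq0 //.
Qed.

Lemma sum_step u : \sum_v (if G u v then step else 0) = (deg G u)%:R * step.
Proof.
rewrite -big_mkcond /= sumr_const [RHS]mulr_natl /deg cardsE.
by congr (_ *+ _); apply: eq_card => v.
Qed.

Lemma walk_mx_sym u v : M u v = M v u.
Proof. by rewrite !mxE eq_sym adj_sym; case: eqP => [->|]. Qed.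

Lemma walk_mx_diag u : 2^-1 <= M u u.
Proof. by rewrite mxE eqxx; have := deg_step u; lra. Qed.

Lemma walk_mx_ge0 u v : 0 <= M u v.
Proof.
have [->|ne] := eqVneq u v; first by apply: le_trans (walk_mx_diag v); rewrite invr_ge0.
by rewrite mxE (negbTE ne); case: ifP => // _; rewrite div1r step_ge0.
Qed.

Lemma walk_mx_row u : \sum_v M u v = 1.
Proof.
rewrite (bigD1 u) //= mxE eqxx.
have := sum_step u; rewrite (bigD1 u) //= adj_irr add0r => E.
rewrite (eq_bigr (fun v => if G u v then step else 0)) ?E ?subrK //.
by move=> v vu; rewrite mxE eq_sym (negbTE vu) div1r.
Qed.

Section Blocks.
Variables (k : nat) (S : {set 'I_n}) (Q : 'I_n -> {set 'I_n}).
Hypothesis fragQ : fragmented G k setT S Q.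

(** Transitions between blocks are deleted, not turned into loops: rows may lose mass, but symmetry,
    the diagonal and domination by [M] survive. *)
Definition block_walk_mx : 'M[R]_n := \matrix_(u, v) if Q u == Q v then M u v else 0.

Lemma block_walk_mx_ge0 u v : 0 <= block_walk_mx u v.
Proof. by rewrite mxE; case: ifP => // _; apply: walk_mx_ge0. Qed.

Lemma block_walk_mx_le u v : block_walk_mx u v <= M u v.
Proof. by rewrite mxE; case: ifP => // _; apply: walk_mx_ge0. Qed.

Lemma block_walk_mx_sym u v : block_walk_mx u v = block_walk_mx v u.
Proof. by rewrite [LHS]mxE [RHS]mxE eq_sym walk_mx_sym. Qed.

Lemma block_walk_mx_row u : \sum_v block_walk_mx u v <= 1.
Proof. by rewrite -(walk_mx_row u); apply: ler_sum => v _; apply: block_walk_mx_le. Qed.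

Lemma block_walk_mx_diag u : 2^-1 <= block_walk_mx u u.
Proof. by rewrite mxE eqxx walk_mx_diag. Qed.

(** Every edge between blocks has an endpoint in [S]. Charged there, it counts once per direction,
    and a vertex has edges of total weight at most 1/2. *)
Lemma block_walk_mx_leak : \sum_u (1 - \sum_v block_walk_mx u v) <= #|S|%:R.
Proof.
pose a u v : R := if G u v then step else 0.
have aS : \sum_(u in S) \sum_v a u v <= 2^-1 * #|S|%:R.
  rewrite mulr_natr -sumr_const; apply: ler_sum => u _.
  by rewrite sum_step deg_step.
apply: le_trans (_ : \sum_u \sum_v ((u \in S)%:R * a u v + (v \in S)%:R * a u v) <= _).
  apply: ler_sum => u _; rewrite -{1}(walk_mx_row u) -sumrB; apply: ler_sum => v _.
  have a0 : 0 <= a u v by rewrite /a; case: ifP => // _; apply: step_ge0.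
  rewrite [block_walk_mx _ _]mxE; case: ifP => [_|/eqP neQ].
    by rewrite subrr addr_ge0 // mulr_ge0 ?ler0n.
  have uv : u != v by apply: contra_notN neQ => /eqP->.
  rewrite subr0 mxE (negbTE uv) div1r -/(a u v).
  case: (boolP (u \in S)) => [_|uS]; first by rewrite mul1r ler_wpDr // mulr_ge0 ?ler0n.
  case: (boolP (v \in S)) => [_|vS]; first by rewrite mul1r mul0r add0r.
  rewrite !mul0r addr0 /a; case: ifP => // Guv; case: neQ.
  by case: fragQ => _ _; apply; rewrite ?inE ?uS ?vS.
under eq_bigr do rewrite big_split.
rewrite big_split /= [X in _ + X]exchange_big /=.
have E (f : 'I_n -> 'I_n -> R) : \sum_u \sum_v (u \in S)%:R * f u v =
    \sum_(u in S) \sum_v f u v :> R.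
  rewrite [RHS]big_mkcond; apply: eq_bigr => u _; rewrite -mulr_sumr.
  by case: (_ \in _); rewrite ?mul1r ?mul0r.
rewrite E (E (fun v u => a u v)).
have -> : \sum_(u in S) \sum_v a v u = \sum_(u in S) \sum_v a u v.
  by apply: eq_bigr => u _; apply: eq_bigr => v _; rewrite /a adj_sym.
lra.
Qed.

Lemma block_pow_support t u s : Q u != Q s -> (block_walk_mx ^+ t) u s = 0.
Proof.
elim: t u => [|t IH] u ne.
  by rewrite expr0 -idmxE mxE; case: eqP => // us; rewrite us eqxx in ne.
rewrite mxpowS big1 // => w _; rewrite [block_walk_mx u w]mxE.
case: eqP => [E|]; last by rewrite mul0r.
by rewrite IH ?mulr0 // -E.
Qed.

(** * Comparison with the truncated walk *)

Variable eps : R.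
Hypothesis eps_gt0 : 0 < eps.
Local Notation rho := (rho d eps).
Local Notation W := (trunc_walk_from d eps G).

Lemma rho_ge0 : 0 <= rho.
Proof. by rewrite mulr_ge0 ?invr_ge0 ?exprn_ge0 ?ler0n // ltW. Qed.

Lemma trunc_walkS s t u : W s t.+1 u 0 =
  let a := \sum_v M u v * W s t v 0 in if a <= rho then 0 else a.
Proof. by rewrite /= [in LHS]mxE [in LHS]mxE. Qed.

Lemma trunc_walk_ge0 s t u : 0 <= W s t u 0.
Proof.
elim: t u => [|t IH] u; first by rewrite /= mxE ler0n.
rewrite trunc_walkS /=; case: ifP => // _.
by apply: sumr_ge0 => v _; rewrite mulr_ge0 ?walk_mx_ge0.
Qed.

Lemma trunc_walk_mass s t : \sum_u W s t u 0 <= 1.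
Proof.
elim: t => [|t IH].
  rewrite (bigD1 s) //= big1 ?addr0 ?mxE ?eqxx // => u us.
  by rewrite mxE (negbTE us).
apply: le_trans IH.
apply: le_trans (_ : \sum_u \sum_v M u v * W s t v 0 <= _).
  apply: ler_sum => u _; rewrite trunc_walkS /=; case: ifP => // _.
  by apply: sumr_ge0 => v _; rewrite mulr_ge0 ?walk_mx_ge0 ?trunc_walk_ge0.
rewrite exchange_big /=; apply: ler_sum => v _; rewrite -mulr_suml.
by under eq_bigr do rewrite walk_mx_sym; rewrite walk_mx_row mul1r.
Qed.

(** Row sums at most 1 do not amplify the earlier error, and one truncation lowers a coordinate by
    at most [rho]. *)
Lemma trunc_walk_ge_block s t u : (block_walk_mx ^+ t) u s - t%:R * rho <= W s t u 0.
Proof.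
elim: t u => [|t IH] u.
  by rewrite mul0r subr0 expr0 -idmxE /= !mxE andbT.
rewrite trunc_walkS mxpowS /=; set a := \sum_v M u v * _.
have r0 := rho_ge0.
have : \sum_v block_walk_mx u v * (block_walk_mx ^+ t) v s - t%:R * rho <= a.
  apply: le_trans (_ : \sum_v block_walk_mx u v *
    ((block_walk_mx ^+ t) v s - t%:R * rho) <= _).
    under [X in _ <= X]eq_bigr do rewrite mulrBr.
    rewrite sumrB -mulr_suml lerD2l lerN2 ler_piMl ?block_walk_mx_row //.
    by rewrite mulr_ge0.
  apply: ler_sum => v _; apply: le_trans (_ : block_walk_mx u v * W s t v 0 <= _).
    by rewrite ler_wpM2l // block_walk_mx_ge0.
  by rewrite ler_wpM2r ?trunc_walk_ge0 // block_walk_mx_le.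
rewrite -natr1 mulrDl mul1r => le.
by case: (leP a rho) => ? ; lra.
Qed.

(** Outside the block of [s] the confined walk vanishes, so only the at most [k] coordinates of
    [Q s] incur a loss, however large [F] is. *)
Lemma trunc_walk_return (F : {set 'I_n}) s t :
  \sum_(u in F) (block_walk_mx ^+ t) u s - k%:R * (t%:R * rho) <= \sum_(u in F) W s t u 0.
Proof.
have tr0 : 0 <= t%:R * rho by rewrite mulr_ge0 ?rho_ge0.
case: fragQ => inQ cQ _.
apply: le_trans (_ : \sum_(u in F)
  ((block_walk_mx ^+ t) u s - (u \in Q s)%:R * (t%:R * rho)) <= _).
  rewrite sumrB lerD2l lerN2 -mulr_suml ler_wpM2r //.
  apply: le_trans (_ : \sum_u (u \in Q s)%:R <= _).
    by rewrite big_mkcond; apply: ler_sum => u _; case: ifP => // _; apply: ler0n.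
  rewrite -natr_sum ler_nat; apply: leq_trans (cQ s).
  by rewrite -sum1_card [X in (_ <= X)%N]big_mkcond; apply: leq_sum => u _; case: (_ \in _).
apply: ler_sum => u _; case: (boolP (u \in Q s)) => us.
  by rewrite mul1r trunc_walk_ge_block.
rewrite mul0r subr0 block_pow_support ?trunc_walk_ge0 //.
by apply: contraNneq us => <-.
Qed.

End Blocks.
End WalkMatrix.

(** * Choice of constants and averaging *)

(** A term is at most [b] if it reaches [theta], and below [theta] otherwise. *)
Lemma reverse_markov (R : realFieldType) (T : finType) (F : {set T})
    (g : T -> R) (b theta : R) :
  0 <= theta -> (forall s, g s <= b) ->
  \sum_(s in F) g s <= b * #|[set s in F | theta <= g s]|%:R + theta * #|F|%:R.
Proof.
move=> th0 gb; rewrite !mulr_natr -!sumr_const.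
rewrite [X in _ <= X + _](_ : _ = \sum_(s in F) if theta <= g s then b else 0).
  rewrite -big_split /=; apply: ler_sum => s _.
  by case: (leP theta (g s)) => [_|/ltW gs] /=; rewrite ?add0r // ler_wpDr.
by rewrite -big_mkcondr; apply: eq_bigl => s; rewrite inE.
Qed.

Lemma sum_count_exchange (R : pzSemiRingType) (T : finType) (F : {set T}) (I : Type)
    (ts : seq I) (P : T -> I -> bool) :
  \sum_(s in F) (count (P s) ts)%:R = \sum_(t <- ts) #|[set s in F | P s t]|%:R :> R.
Proof.
rewrite -!natr_sum; congr _%:R.
under eq_bigr do rewrite -sum1_count big_mkcond.
rewrite exchange_big /=; apply: eq_bigr => t _.
by rewrite -big_mkcondr -sum1_card; apply: eq_bigl => s; rewrite inE.
Qed.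

Lemma exp2_between W : (8 <= W)%N -> exists2 q, (W * q.+1 <= 2 ^ q)%N & (2 ^ q <= 4 * W ^ 2)%N.
Proof.
move=> W8; set b := (trunc_log 2 W).+1.
have W0 : (0 < W)%N by lia.
have Wb : (W <= 2 ^ b)%N by apply/ltnW/trunc_log_ltn.
have bW : (2 ^ b <= 2 * W)%N by rewrite expnS leq_mul2l trunc_logP.
have b3 : (3 <= b)%N.
  rewrite leqNgt; apply/negP => b2.
  have := leq_trans Wb (leq_pexp2l (isT : (0 < 2)%N) (b2 : (b <= 2)%N)); lia.
(* One factor [2 ^ b] dominates [W], the other dominates [2b + 1] because [b >= 3]. *)
exists (b * 2)%N.
  rewrite expnM expnS expn1; apply: leq_mul => //.
  rewrite -(subnK b3); elim: (b - 3)%N => // i IH; rewrite addSn expnS; lia.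
by rewrite expnM -[4%N]/(2 ^ 2)%N -expnMn leq_exp2r.
Qed.

Section WalkConstants.
Variables (R : realType) (d : nat) (eps : R).
Hypotheses (d_gt0 : (0 < d)%N) (eps_gt0 : 0 < eps) (eps_le1 : eps <= 1).

Let d1 : 1 <= d%:R :> R. Proof. by rewrite ler1n. Qed.
Let d0 : d%:R != 0 :> R. Proof. by rewrite pnatr_eq0 -lt0n. Qed.

Lemma ell_gt0 : 0 < ell d eps.
Proof. by rewrite mulr_gt0 ?invr_gt0 ?exprn_gt0 // ltr0n. Qed.

Lemma ell_ge : eps^-1 <= ell d eps.
Proof.
have e30 : eps ^+ 30 <= eps by rewrite -[X in _ <= X]expr1 ler_wiXn2l // ltW.
have : eps^-1 <= eps ^- 30 by rewrite lef_pV2 // posrE exprn_gt0.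
move/le_trans; apply; rewrite ler_peMl ?exprn_ege1 //.
by rewrite invr_ge0 exprn_ge0 // ltW.
Qed.

(** The fourth power stands for the block size: [2 ^ q] will be of order [(ell / eps)^4]. *)
Lemma ell_rho_le : (ell d eps / eps) ^+ 4 * (ell d eps * rho d eps) <= eps ^+ 2.
Proof.
rewrite /ell /rho.
(* The denominators contain [eps] to the power [4 * 31 + 30 = 154]. *)
have -> : eps ^+ 3000 = eps ^+ 154 * eps ^+ 2846 by rewrite -exprD.
have e2 : eps ^+ 2846 <= eps ^+ 2 by rewrite ler_wiXn2l // ltW.
have z0 : 0 <= eps ^+ 2846 by rewrite exprn_ge0 // ltW.
move: e2 z0; move: (eps ^+ 2846) => z le z0; apply: le_trans le.
have -> : (d%:R ^+ 6 * eps ^- 30 / eps) ^+ 4 *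
    (d%:R ^+ 6 * eps ^- 30 * (d%:R ^- 60 * (eps ^+ 154 * z))) = d%:R ^- 30 * z.
  by field; rewrite d0 gt_eqF.
by rewrite ler_piMl // invf_le1 ?exprn_ege1 // exprn_gt0 // ltr0n.
Qed.

(** [r] is the separator parameter, large enough to make the leak small, and [2 ^ q] the resulting
    block size. The constant comes from [2 ^ q <= 4 (D r^2)^2] and [r <= 201 ell / eps]. *)
Lemma constants_exist (D : nat) : (0 < D)%N ->
  1000 * (4 * D%:R ^+ 2 * 201 ^+ 4) * eps < 1 ->
  exists r q, [/\ (1 < r)%N, (D * r ^ 2 * q.+1 <= 2 ^ q)%N,
    200 * (ell d eps / eps) <= r%:R &
    (2 ^ q)%:R * (ell d eps * rho d eps) <= beta eps / 100].
Proof.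
move=> D0; set C : R := 4 * _ * _ => eC.
have C0 : 0 < C by rewrite /C !mulr_gt0 // ?exprn_gt0 ?ltr0n.
have lr0 : 0 <= ell d eps * rho d eps.
  by rewrite mulr_ge0 ?rho_ge0 // ltW // ell_gt0.
have lr := ell_rho_le; have leE : 1 <= ell d eps / eps.
  rewrite ler_pdivlMr // mul1r; apply: le_trans eps_le1 _.
  by apply: le_trans ell_ge; rewrite invf_ge1.
move: lr leE lr0; move: (ell d eps / eps) (ell d eps * rho d eps) => y z lr y1 z0.
pose r := (Num.truncn (200 * y)).+1.
have r_lo : 200 * y < r%:R by rewrite truncnS_gt.
have r_hi : r%:R <= 201 * y.
  have : (Num.truncn (200 * y))%:R <= 200 * y.
    by rewrite truncn_le mulr_ge0 // (le_trans ler01).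
  by rewrite /r -natr1; move: (Num.truncn _) => t; lra.
have r2 : (1 < r)%N.
  by rewrite -(ltr_nat R); apply: lt_trans r_lo; lra.
have [q qW Wq] : exists2 q, (D * r ^ 2 * q.+1 <= 2 ^ q)%N &
    (2 ^ q <= 4 * (D * r ^ 2) ^ 2)%N.
  apply: exp2_between; have : (3 ^ 2 <= r ^ 2)%N.
    rewrite leq_exp2r // -(ler_nat R); apply: le_trans (ltW r_lo).
    by lra.
  by move/(leq_mul D0); apply: leq_trans.
exists r, q; split=> //; first exact: ltW.
have : (2 ^ q)%:R <= C * y ^+ 4.
  apply: le_trans (_ : 4 * (D%:R * r%:R ^+ 2) ^+ 2 <= _).
    by rewrite -natrX -natrM -natrX -natrM ler_nat.
  have : r%:R ^+ 4 <= (201 * y) ^+ 4.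
    by rewrite lerXn2r ?nnegrE ?ler0n // mulr_ge0 // (le_trans ler01).
  rewrite /C exprMn => hr; rewrite exprMn -exprM.
  by rewrite mulrA -[X in _ <= X]mulrA ler_pM2l // mulr_gt0 ?exprn_gt0 ?ltr0n.
move=> le; have := ler_wpM2r z0 le; move/le_trans; apply.
rewrite -mulrA; apply: le_trans (_ : C * eps ^+ 2 <= _); first by rewrite ler_pM2l.
rewrite /beta expr2 mulrA; have := ler_wpM2r (ltW eps_gt0) (ltW eC).
by move: C {eC C0 le} => C; lra.
Qed.

End WalkConstants.

(** The leak leaves mass [9/10 |F|], so the confined return mass is at least [81/200 |F|^2 / n],
    hence [81/200 beta |F|]. Truncation costs [beta/100] per source, and
    [81/200 - 1/100 = 395/1000]. *)
Lemma trunc_return_average (R : realType) (d n k : nat) (G : sgraph n) (eps : R)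
    (S F : {set 'I_n}) Q t :
  (0 < d)%N -> (forall v, (deg G v <= d)%N) -> (0 < n)%N -> 0 < eps ->
  fragmented G k setT S Q ->
  beta eps * n%:R <= #|F|%:R ->
  t%:R * #|S|%:R <= beta eps / 10 * n%:R ->
  k%:R * (t%:R * rho d eps) <= beta eps / 100 ->
  395 / 1000 * beta eps * #|F|%:R <=
    \sum_(s in F) \sum_(u in F) trunc_walk_from d eps G s t u 0.
Proof.
move=> d0 dG n0 e0 fQ bF leakS loss.
pose N := block_walk_mx R d G Q.
have N0 := block_walk_mx_ge0 R d0 dG Q; have Nsym := @block_walk_mx_sym R d n G Q.
have Nrow := block_walk_mx_row R d0 dG Q; have Ndiag := block_walk_mx_diag R d0 dG Q.
have nR : 0 < n%:R :> R by rewrite ltr0n.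
have mass : 9 / 10 * #|F|%:R <= \sum_u occupation N F t./2 u.
  apply: le_trans (occupation_mass N0 Nsym Nrow F t./2).
  have : (t./2)%:R * (\sum_u (1 - \sum_v N u v)) <= t%:R * #|S|%:R.
    apply: ler_pM; rewrite ?ler0n //.
    - by apply: sumr_ge0 => u _; rewrite subr_ge0 Nrow.
    - by rewrite ler_nat -divn2 leq_div.
    - exact: block_walk_mx_leak fQ.
  move/le_trans => /(_ _ leakS).
  move: (_ * \sum_u _) bF => x; move: (beta eps) (#|F|%:R : R) => b f bF; clear -bF; nra.
have m0 : 0 <= 9 / 10 * #|F|%:R :> R by rewrite mulr_ge0 ?ler0n // divr_ge0.
have := return_mass_ge N0 Nsym Ndiag n0 m0 mass.
rewrite /occupation exchange_big /= => ret.
have dens : beta eps * #|F|%:R <= #|F|%:R ^+ 2 / n%:R.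
  by rewrite ler_pdivlMr // expr2 mulrAC ler_wpM2r.
apply: le_trans (_ : \sum_(s in F) (\sum_(u in F) (N ^+ t) u s - beta eps / 100) <= _).
  rewrite sumrB sumr_const -[beta eps / 100 *+ _]mulr_natr.
  have E : (9 / 10 * #|F|%:R) ^+ 2 / n%:R / 2 = 81 / 200 * (#|F|%:R ^+ 2 / n%:R) :> R.
    by field; rewrite gt_eqF.
  move: ret dens; rewrite {}E.
  move: (#|F|%:R ^+ 2 / n%:R : R) (\sum_(s in F) _) (beta eps) (#|F|%:R : R) => x y b f.
  by clear; nra.
apply: ler_sum => s _; apply: le_trans (trunc_walk_return d0 dG fQ e0 F s t).
by rewrite lerD2l lerN2.
Qed.

(** Reverse Markov over sources at each fixed time, double counting of good pairs, then reverse
    Markov for the number of good times per source. *)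
Lemma many_good_sources (R : realFieldType) (T : finType) (F : {set T}) (ts : seq nat)
    (g : T -> nat -> R) (c theta tau : R) :
  0 <= theta -> 0 <= tau -> (forall s t, g s t <= 1) ->
  (forall t, t \in ts -> c * #|F|%:R <= \sum_(s in F) g s t) ->
  ((c - theta) * (size ts)%:R - tau) * #|F|%:R <= (size ts)%:R *
    #|[set s in F | tau <= (count (fun t => theta <= g s t) ts)%:R]|%:R.
Proof.
move=> th0 tau0 g1 avg.
have cnt_le s : (count (fun t => theta <= g s t) ts)%:R <= (size ts)%:R :> R.
  by rewrite ler_nat count_size.
have := reverse_markov F tau0 cnt_le.
rewrite (sum_count_exchange R F ts (fun s t => theta <= g s t)).
have : (c - theta) * #|F|%:R * (size ts)%:R <=
    \sum_(t <- ts) #|[set s in F | theta <= g s t]|%:R.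
  rewrite -sum1_size natr_sum mulr_sumr big_seq [X in _ <= X]big_seq.
  apply: ler_sum => t tts; rewrite mulr1.
  have /= := reverse_markov F th0 (g1 ^~ t); have := avg t tts.
  rewrite mul1r mulrBl.
  by move: (\sum_(s in F) _) (#|[set _ in _ | _]|%:R : R) => a x le1 le2; lra.
move: (\sum_(t <- ts) _) (#|[set _ in _ | _]|%:R : R) (#|F|%:R : R) ((size ts)%:R : R).
by clear; move=> a b f z le1 le2; lra.
Qed.

Theorem theorem6p1 (R : realType) (h : nat) (H : sgraph h) :
  exists2 eps0 : R, 0 < eps0 &
    forall eps : R, 0 < eps -> eps < eps0 ->
    forall P : graph_family, minor_closed P -> excludes_minor P H ->
    forall (d n : nat) (G : sgraph n),
      (0 < d)%N ->
      P n G ->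
      connected G ->
      (forall v : 'I_n, (deg G v <= d)%N) ->
    forall F : {set 'I_n},
      beta eps * n%:R <= #|F|%:R ->
      beta eps ^+ 2 * n%:R / 8 <=
        #|[set s in F | beta eps * ell d eps / 8 <=
                        (num_good_timesteps d eps G F s)%:R]|%:R.
Proof.
have [K K0 quinticK] := quintic_le_geometric.
pose D := (2 * h.+1 ^ 2 * K)%N.
have D0 : (0 < D)%N by rewrite /D !muln_gt0 K0 andbT /=; lia.
have C1 : 1 <= 4 * D%:R ^+ 2 * 201 ^+ 4 :> R.
  by rewrite !mulr_ege1 ?exprn_ege1 ?ler1n.
(* This is the smallness required by [constants_exist]; as the constant is at least 1, it also gives
   [1000 * eps < 1]. *)
exists (1000 * (4 * D%:R ^+ 2 * 201 ^+ 4))^-1.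
  by rewrite invr_gt0 mulr_gt0 // (lt_le_trans ltr01).
move=> eps e0 elt P _ exclP d n G d0 PG _ dG F bF.
have [n0|n0] := posnP n.
  by rewrite [n%:R](_ : _ = 0) ?mulr0 ?mul0r ?ler0n // n0.
have eC : 1000 * (4 * D%:R ^+ 2 * 201 ^+ 4) * eps < 1.
  by rewrite -lter_pdivlMl ?mulr1 // mulr_gt0 // (lt_le_trans ltr01).
have e1000 : 1000 * eps < 1.
  by move: C1 eC; move: (4 * _ * _) => C; clear -e0; nra.
have eps1 : eps <= 1 by clear -e1000 e0; lra.
have [r [q [r2 qW r_lo loss]]] := constants_exist d0 e0 eps1 D0 eC.
have [|S [Q [fQ leS]]] := @hyperfinite _ G (@adj_sym _ G) h K r q
   (fun Bs => @no_clique_model h H n G Bs (exclP n G PG)) quinticK r2.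
  by apply: leq_trans qW; rewrite /D leq_mul2r; apply/orP; right; rewrite mulnAC.
rewrite card_ord in leS.
have l0 := ell_gt0 d0 e0; have lbig := ell_ge d0 e0 eps1.
have {}lbig : 1000 <= ell d eps.
  by apply: le_trans lbig; rewrite -[eps^-1]mul1r ler_pdivlMr // ltW.
have leakS : ell d eps * #|S|%:R <= beta eps / 10 * n%:R.
  have : 200 * (ell d eps / eps) * #|S|%:R <= 2 * n%:R.
    apply: le_trans (_ : r%:R * #|S|%:R <= _); first by rewrite ler_wpM2r.
    by rewrite -!natrM ler_nat.
  move/(ler_wpM2l (ltW e0)).
  have -> : eps * (200 * (ell d eps / eps) * #|S|%:R) = 200 * (ell d eps * #|S|%:R).
    by field; rewrite gt_eqF.
  rewrite /beta; move: (ell d eps * _) (n%:R : R) => x y; clear; lra.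
have ts_le t : t \in timesteps d eps -> t%:R <= ell d eps.
  rewrite mem_iota add1n ltnS => /andP[_ tL].
  apply: le_trans (_ : (Num.truncn (ell d eps))%:R <= _); first by rewrite ler_nat.
  by rewrite truncn_le ltW.
have b0 : 0 < beta eps by rewrite divr_gt0.
have th0 : 0 <= beta eps / 16 by rewrite divr_ge0 // ltW.
have tau0 : 0 <= beta eps * ell d eps / 8 by rewrite divr_ge0 // mulr_ge0 // ltW.
have walk1 s t : \sum_(u in F) trunc_walk_from d eps G s t u 0 <= 1.
  apply: le_trans (trunc_walk_mass d0 dG eps s t); rewrite big_mkcond.
  by apply: ler_sum => u _; case: ifP => // _; apply: trunc_walk_ge0.
have avg t : t \in timesteps d eps -> 395 / 1000 * beta eps * #|F|%:R <=
    \sum_(s in F) \sum_(u in F) trunc_walk_from d eps G s t u 0.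
  move=> /ts_le tl; apply: (trunc_return_average d0 dG n0 e0 fQ bF).
    by apply: le_trans leakS; rewrite ler_wpM2r.
  apply: le_trans loss; rewrite ler_wpM2l ?ler0n // ler_wpM2r // rho_ge0 //.
set good := [set s in F | _].
have main : ((395 / 1000 * beta eps - beta eps / 16) * (size (timesteps d eps))%:R -
    beta eps * ell d eps / 8) * #|F|%:R <= (size (timesteps d eps))%:R * #|good|%:R :=
  many_good_sources th0 tau0 walk1 avg.
move: main; rewrite /timesteps size_iota.
have lL : ell d eps < (Num.truncn (ell d eps))%:R + 1 by rewrite natr1 truncnS_gt.
move: #|good| (beta eps) (ell d eps) (Num.truncn (ell d eps)) b0 bF lL lbig.
move=> g b l L b0 bF lL lbig.
move=> main; have L0 : 0 < L%:R :> R by clear -lL lbig; lra.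
have w0 : 0 <= b * #|F|%:R by rewrite mulr_ge0 ?ler0n // ltW.
have bbn := ler_wpM2l (ltW b0) bF.
apply: le_trans (_ : b * #|F|%:R / 8 <= _).
  by rewrite expr2 -[_ * n%:R]mulrA ler_wpM2r // invr_ge0.
rewrite -(ler_pM2l L0); apply: le_trans main.
have -> : ((395 / 1000 * b - b / 16) * L%:R - b * l / 8) * #|F|%:R =
    (b * #|F|%:R) * ((395 / 1000 - 16^-1) * L%:R - l / 8) by ring.
have -> : L%:R * (b * #|F|%:R / 8) = (b * #|F|%:R) * (L%:R / 8) by ring.
(* [395/1000 - 1/16 - 1/8] exceeds [1/8], and [l >= 1000] leaves room for the rounding
   [l < L + 1]. *)
by rewrite ler_wpM2l //; clear -lL lbig; lra.
Qed.
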